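(* Let $(\Omega_1,\mathcal{A}_1),\dots,(\Omega_r,\mathcal{A}_r)$ be measurable spaces, $\Omega=\Omega_1\times\dots\times\Omega_r$, $\mathcal{A}=\mathcal{A}_1\otimes\dots\otimes\mathcal{A}_r$, and for every $i\in\{1,\dots,r\}$ let $\pi_i$ be a Markov kernel $\left(\prod_{j\neq i}\Omega_j\right)\times\mathcal{A}_i\to[0,1]$. If there exists a unique Gibbs compromise $P_G$ between the Markov kernels $(\pi_i)_{1\le i\le r}$, then: 1. $P_G$ is absolutely continuous with respect to any compromise between $(\pi_i)_{1\le i\le r}$; 2. for any positive measure $\lambda$ on $\mathcal{A}$ such that $P_G$ is absolutely continuous with respect to $\lambda$, $P_G$ is the unique optimal compromise with respect to $\lambda$ between $(\pi_i)_{1\le i\le r}$.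
   Context: $r$ is a positive integer. A Markov kernel $\pi:A\times\mathcal{B}\to[0,1]$ (for measurable spaces $(A,\mathcal{A}'),(B,\mathcal{B})$) is a map such that $\pi(x,\cdot)$ is a probability distribution on $\mathcal{B}$ for every $x\in A$ and $\pi(\cdot,S)$ is measurable for every $S\in\mathcal{B}$; write $\pi(S|x)=\pi(x,S)$. For a probability distribution $\phi$ on $\mathcal{A}$, $\phi_{-i}$ (the $i$-th $(r-1)$-marginal distribution) is the probability distribution on $\bigotimes_{j\ne i}\mathcal{A}_j$ obtained as the image of $\phi$ under the projection that drops the $i$-th coordinate. For a probability distribution $m_{\neq i}$ on $\bigotimes_{j\neq i}\mathcal{A}_j$, $\pi_i m_{\neq i}$ is the probability distribution on $\mathcal{A}$ with $\pi_i m_{\neq i}(S_{<i}\times S_i\times S_{>i})=\int_{S_{<i}\times S_{>i}}\pi_i(S_i|\omega_{-i})\,dm_{\neq i}(\omega_{-i})$ for $S_{<i}\in\bigotimes_{j<i}\mathcal{A}_j$, $S_i\in\mathcal{A}_i$, $S_{>i}\in\bigotimes_{j>i}\mathcal{A}_j$. A sequence $(m_{\neq i})_{1\le i\le r}$, with $m_{\ne i}$ a probability distribution on $\bigotimes_{j\neq i}\mathcal{A}_j$, is compatible with $(\pi_i)_{1\le i\le r}$ if $m_{\neq i}=\frac1r\sum_{j=1}^r(\pi_j m_{\neq j})_{-i}$ for every $i$. A compromise between $(\pi_i)_{1\le i\le r}$ is a probability distribution $P$ on $\mathcal{A}$ such that (1) for every $i$, $\pi_iP_{-i}$ is absolutely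 continuous with respect to $P$; (2) the sequence $(P_{-i})_{1\le i\le r}$ is compatible with $(\pi_i)_{1\le i\le r}$. A Gibbs compromise between $(\pi_i)_{1\le i\le r}$ is a probability distribution $P_G$ on $\mathcal{A}$ such that $P_G=\frac1r\sum_{i=1}^r\pi_i(P_G)_{-i}$. For a positive measure $\lambda$ on $\mathcal{A}$, an optimal compromise with respect to $\lambda$ is a compromise that is absolutely continuous with respect to $\lambda$ and that minimizes, over all compromises absolutely continuous with respect to $\lambda$, the functional $$E_\lambda(P)=\sum_{i=1}^r\int_{\Omega}\left[\frac{d(\pi_iP_{-i})}{d\lambda}(\omega)-\frac{dP}{d\lambda}(\omega)\right]^2d\lambda(\omega).$$
   Formalization: Uniqueness of the optimal compromise is claimed only when E_λ(P_G) is finite (otherwise every compromise absolutely continuous w.r.t. λ has infinite E_λ and uniqueness can fail); E_λ(P) is set to +∞ when the densities do not exist, as may happen for non-σ-finite λ. *)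

(* Defs.v *)
From HB Require Import structures.
From mathcomp Require Import all_boot all_order all_algebra.
From mathcomp Require Import all_classical all_reals all_analysis.
From mathcomp Require Import measurable_realfun.

Set Implicit Arguments.
Unset Strict Implicit.
Unset Printing Implicit Defensive.
Import Order.TTheory GRing.Theory Num.Theory.

Local Open Scope classical_set_scope.
Local Open Scope ring_scope.
Local Open Scope ereal_scope.

Definition mprod_display (I : Type) : (I -> measure_display) -> measure_display.
Proof. by move=> _; exact: default_measure_display. Qed.

Definition mprod (I : Type) (d : I -> measure_display)
  (T : forall i, measurableType (d i)) : Type := forall i, T i.

Definition mprod_coord (I : Type) (d : I -> measure_display)
  (T : forall i, measurableType (d i)) (i : I) (w : mprod T) : T i := w i.

Section mprod_instance.
Context (I : Type) (d : I -> measure_display).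
Variable T : forall i, measurableType (d i).

Definition mprod_gen : set (set (mprod T)) :=
  \bigcup_(i in [set: I])
    preimage_set_system setT (@mprod_coord I d T i) measurable.

Let mprod0 : <<s mprod_gen >> set0.
Proof. exact: sigma_algebra0. Qed.

Let mprodC A : <<s mprod_gen >> A -> <<s mprod_gen >> (~` A).
Proof. exact: sigma_algebraC. Qed.

Let mprodU (F : (set (mprod T))^nat) : (forall n, <<s mprod_gen >> (F n)) ->
  <<s mprod_gen >> (\bigcup_n F n).
Proof. exact: sigma_algebra_bigcup. Qed.

HB.instance Definition _ := Pointed.copy (mprod T) (forall i, T i).
HB.instance Definition _ := @isMeasurable.Build (mprod_display d)
  (mprod T) <<s mprod_gen >> mprod0 mprodC mprodU.

Lemma measurable_mprod_coord i : measurable_fun setT (@mprod_coord I d T i).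
Proof.
move=> _ A mA; rewrite setTI; apply: sub_sigma_algebra.
by exists i => //; exists A => //; rewrite setTI.
Qed.

Lemma measurable_mprodP d' (S : measurableType d') (f : S -> mprod T) :
  (forall i, measurable_fun setT (fun x => f x i)) -> measurable_fun setT f.
Proof.
move=> mf; apply: (measurability mprod_gen) => //.
move=> _ [_ [i _ [A mA <-]] <-].
have := mf i measurableT A mA.
by rewrite !setTI.
Qed.

End mprod_instance.

Section drop_insert.
Context (r : nat) (d : 'I_r -> measure_display).
Variable T : forall i, measurableType (d i).

Definition others (i : 'I_r) :=
  @mprod {j : 'I_r | j != i} (fun j => d (sval j)) (fun j => T (sval j)).

HB.instance Definition _ i := Measurable.on (others i).

Definition drop_coord (i : 'I_r) (w : mprod T) : others i :=
  fun j => w (sval j).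
Arguments drop_coord : clear implicits.

Definition insert_coord (i : 'I_r) (u : others i) (x : T i) : mprod T :=
  fun j => match eq_comparable j i with
  | left e => eq_rect i (fun k => T k : Type) x j (esym e)
  | right ne => u (exist _ j (introN eqP ne))
  end.

Lemma insert_coord_same i (u : others i) (x : T i) : insert_coord u x i = x.
Proof.
rewrite /insert_coord; case: eq_comparable => [e|//].
by rewrite (eq_irrelevance (esym e) erefl).
Qed.

Lemma drop_insert_coord i (u : others i) (x : T i) :
  drop_coord i (insert_coord u x) = u.
Proof.
apply/functional_extensionality_dep => -[j ne].
rewrite /drop_coord /insert_coord /=.
case: eq_comparable => [e|ne']; first by case/eqP: (ne).
by rewrite (bool_irrelevance (introN eqP ne') ne).
Qed.

Lemma measurable_drop_coord i : measurable_fun setT (drop_coord i).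
Proof. by apply: measurable_mprodP => j; exact: measurable_mprod_coord. Qed.

HB.instance Definition _ i :=
  isMeasurableFun.Build _ _ _ _ (drop_coord i) (@measurable_drop_coord i).

Lemma measurable_insert_coord i : measurable_fun setT
  (fun z : others i * T i => insert_coord z.1 z.2).
Proof.
apply: measurable_mprodP => j; rewrite /insert_coord.
case: eq_comparable => [e|ne]; last first.
  apply: (measurableT_comp (f := @mprod_coord _ _ _ (exist _ j (introN eqP ne)))
    _ measurable_fst).
  exact: measurable_mprod_coord.
by subst j; exact: measurable_snd.
Qed.

End drop_insert.
Arguments drop_coord {r d T} i w.

Section kernel_measure.
Context (R : realType) (r : nat) (d : 'I_r -> measure_display).
Variable T : forall i, measurableType (d i).

Definition marginal (i : 'I_r) (P : probability (mprod T) R) :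
  probability (others T i) R := distribution P (drop_coord i).

(* Defined on every measurable set by sectioning, rather than on rectangles
   only; ker_measure_rect is the formula on rectangles. *)
Definition ker_measure (i : 'I_r) (k : R.-pker (others T i) ~> T i)
    (m : probability (others T i) R) (S : set (mprod T)) : \bar R :=
  \int[m]_u k u [set x | S (insert_coord u x)].

Section instance.
Variables (i : 'I_r) (k : R.-pker (others T i) ~> T i).
Variable m : probability (others T i) R.

Let section_setE (S : set (mprod T)) (u : others T i) :
  [set x | S (insert_coord u x)] =
  xsection ((fun z : others T i * T i => insert_coord z.1 z.2) @^-1` S) u.
Proof. by apply/seteqP; split => x; rewrite /xsection/= inE. Qed.

Let msection (S : set (mprod T)) (u : others T i) : measurable S ->
  measurable [set x | S (insert_coord u x)].
Proof.
move=> mS; rewrite section_setE; apply: measurable_xsection.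
by rewrite -[X in measurable X]setTI; exact: measurable_insert_coord.
Qed.

Let mker (S : set (mprod T)) : measurable S ->
  measurable_fun setT (fun u => k u [set x | S (insert_coord u x)]).
Proof.
move=> mS; rewrite (_ : (fun u => _) = (fun u => k u (xsection
  ((fun z : others T i * T i => insert_coord z.1 z.2) @^-1` S) u))); last first.
  by apply/funext => u; rewrite section_setE.
apply: measurable_fun_xsection_finite_kernel; rewrite inE.
by rewrite -[X in measurable X]setTI; exact: measurable_insert_coord.
Qed.

Let ker_measure0 : ker_measure k m set0 = 0.
Proof.
by rewrite /ker_measure integral0_eq// => u _; rewrite [X in k u X](_ : _ = set0).
Qed.

Let ker_measure_ge0 S : 0 <= ker_measure k m S.
Proof. exact: integral_ge0. Qed.

Let ker_measure_sigma_additive : semi_sigma_additive (ker_measure k m).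
Proof.
move=> F mF tF mUF.
have -> : ker_measure k m (\bigcup_n F n) =
          \sum_(n <oo) ker_measure k m (F n).
  rewrite -integral_nneseries//; last by move=> n; exact: mker.
  apply: eq_integral => u _.
  rewrite [X in k u X](_ : _ = \bigcup_n [set x | F n (insert_coord u x)])//.
  rewrite measure_bigcup//=.
  - by apply: eq_eseriesl => n; rewrite in_setT.
  - by move=> n _; exact: msection.
  - move=> a b _ _ [x [/= Fa Fb]]; apply: (tF a b) => //.
    by exists (insert_coord u x).
exact: is_cvg_nneseries.
Qed.

HB.instance Definition _ := isMeasure.Build _ _ _ (ker_measure k m)
  ker_measure0 ker_measure_ge0 ker_measure_sigma_additive.

Let ker_measureT : ker_measure k m setT = 1.
Proof.
rewrite /ker_measure (eq_integral (cst 1)).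
  by rewrite integral_cst//= mul1e probability_setT.
by move=> u _; rewrite [X in k u X](_ : _ = setT) ?prob_kernel.
Qed.

HB.instance Definition _ :=
  Measure_isProbability.Build _ _ _ (ker_measure k m) ker_measureT.

Lemma ker_measure_rect (B : set (others T i)) (C : set (T i)) :
  measurable B -> measurable C ->
  ker_measure k m [set w | B (drop_coord i w) /\ C (w i)] =
  \int[m]_(u in B) k u C.
Proof.
move=> mB mC; rewrite /ker_measure [RHS]integral_mkcond.
apply: eq_integral => u _; rewrite patchE.
case: ifPn => [|] uB.
  congr (k u _); apply/seteqP; split => x /=;
    rewrite drop_insert_coord insert_coord_same; first by case.
  by move: uB; rewrite inE.
rewrite [X in k u X](_ : _ = set0) ?measure0//.
apply/seteqP; split => x //=; rewrite drop_insert_coord => -[Bu _].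
by move: uB; rewrite notin_setE.
Qed.

End instance.

End kernel_measure.

Section density.
Context d (T : measurableType d) (R : realType).

(* Real-valued form of the property characterizing 'd P '/d la in charge.v,
   where la has to be sigma-finite. *)
Definition is_density (la : {measure set T -> \bar R}) (P : probability T R)
    (f : T -> R) : Prop :=
  la.-integrable setT (EFin \o f) /\
  forall A, measurable A -> P A = \int[la]_(x in A) (f x)%:E.

Definition density (la : {measure set T -> \bar R}) (P : probability T R) :
  T -> R := xget (cst 0%R) [set f | is_density la P f].

Lemma densityP (la : {measure set T -> \bar R}) (P : probability T R) :
  (exists f, is_density la P f) -> is_density la P (density la P).
Proof. exact: xgetPex. Qed.

Lemma is_density_Radon_Nikodym
    (la : {sigma_finite_measure set T -> \bar R}) (P : probability T R) :
  P `<< la ->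
  is_density la P (fine \o Radon_Nikodym (charge_of_finite_measure P) la).
Proof.
move=> Pla; have E : EFin \o (fine \o
    Radon_Nikodym (charge_of_finite_measure P) la) =
    Radon_Nikodym (charge_of_finite_measure P) la.
  by apply/funext => x /=; rewrite fineK// Radon_Nikodym_fin_num.
split; first by rewrite E; exact: Radon_Nikodym_integrable.
move=> A mA.
have := @Radon_Nikodym_integral _ _ _ (charge_of_finite_measure P) la A Pla mA.
by rewrite -E.
Qed.

Lemma density_Radon_Nikodym
    (la : {sigma_finite_measure set T -> \bar R}) (P : probability T R) :
  P `<< la ->
  ae_eq la setT (EFin \o density la P)
    (Radon_Nikodym (charge_of_finite_measure P) la).
Proof.
move=> Pla.
have [|idP dP] := @densityP la P.
  by eexists; exact: is_density_Radon_Nikodym.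
apply: integral_ae_eq => //.
move=> A _ mA; rewrite -[LHS]dP//.
exact: (@Radon_Nikodym_integral _ _ _ (charge_of_finite_measure P) la A Pla mA).
Qed.

End density.

Section compromises.
Context (R : realType) (r : nat) (d : 'I_r -> measure_display).
Variable T : forall i, measurableType (d i).
Variable pi : forall i, R.-pker (others T i) ~> T i.

Definition compatible (m : forall i, probability (others T i) R) : Prop :=
  forall i (A : set (others T i)), measurable A ->
    m i A = (r%:R^-1)%:E *
            \sum_(j < r) marginal i (ker_measure (pi j) (m j)) A.

Definition compromise (P : probability (mprod T) R) : Prop :=
  (forall i, ker_measure (pi i) (marginal i P) `<< P) /\
  compatible (fun i => marginal i P).

Definition Gibbs_compromise (P : probability (mprod T) R) : Prop :=
  forall A, measurable A ->
    P A = (r%:R^-1)%:E * \sum_(i < r) ker_measure (pi i) (marginal i P) A.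

Definition has_densities (la : {measure set (mprod T) -> \bar R})
    (P : probability (mprod T) R) : Prop :=
  (exists f, is_density la P f) /\
  forall i, exists f, is_density la (ker_measure (pi i) (marginal i P)) f.

(* When la is sigma-finite and P is a compromise with P `<< la, the densities
   exist by Radon-Nikodym. For other la they may not exist, even if P `<< la;
   the value is then +oo by convention. *)
Definition energy (la : {measure set (mprod T) -> \bar R})
    (P : probability (mprod T) R) : \bar R :=
  if `[< has_densities la P >] then
    \sum_(i < r) \int[la]_w
      ((density la (ker_measure (pi i) (marginal i P)) w
        - density la P w) ^+ 2)%:E
  else +oo.

Definition optimal_compromise (la : {measure set (mprod T) -> \bar R})
    (P : probability (mprod T) R) : Prop :=
  [/\ compromise P, P `<< la &
      forall Q : probability (mprod T) R, compromise Q -> Q `<< la ->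
        energy la P <= energy la Q].

Lemma has_densities_sigma_finite
    (la : {sigma_finite_measure set (mprod T) -> \bar R})
    (P : probability (mprod T) R) :
  compromise P -> P `<< la -> has_densities la P.
Proof.
move=> [piP _] Pla; split; first by eexists; exact: is_density_Radon_Nikodym.
move=> i; eexists; apply: is_density_Radon_Nikodym.
exact: null_dominates_trans (piP i) Pla.
Qed.

End compromises.

(* Main.v *)
Require Import Defs.
From HB Require Import structures.
From mathcomp Require Import all_boot all_order all_algebra.
From mathcomp Require Import all_classical all_reals all_analysis.
From mathcomp Require Import measurable_realfun ring.

Set Implicit Arguments.
Unset Strict Implicit.
Unset Printing Implicit Defensive.

Local Open Scope classical_set_scope.
Local Open Scope ring_scope.
Local Open Scope ereal_scope.

(* If P is a compromise, its Gibbs update P' = r^-1 sum_i pi_i P_{-i} has the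
   same (r-1)-marginals as P, by compatibility. Hence P' is a Gibbs compromise,
   so P' = P_G. This gives P_G << P, and shows that every compromise P has the
   same components nu_i = pi_i P_{-i} as P_G, with P_G the mean of the nu_i.
   Writing f_i, p, q for the densities of nu_i, P_G, P, the function p is the
   mean of the f_i, whence
     sum_i (f_i - q)^2 = sum_i (f_i - p)^2 + r (p - q)^2
   and E_la(P) = E_la(P_G) + r int (p - q)^2. *)

Import Order.TTheory GRing.Theory Num.Theory.

(** * Averages of [r] probability measures *)

Section mean_measure.
Context d (T : measurableType d) (R : realType) (r : nat).
Variable mu : 'I_r -> probability T R.

Definition mean_measure (A : set T) : \bar R :=
  (r%:R^-1)%:E * \sum_(i < r) mu i A.

Let mean_measure0 : mean_measure set0 = 0.
Proof. by rewrite /mean_measure big1 ?mule0// => i _; rewrite measure0. Qed.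

Let mean_measure_ge0 A : 0 <= mean_measure A.
Proof. by rewrite mule_ge0 ?lee_fin ?invr_ge0//; exact: sume_ge0. Qed.

Let mean_measure_sigma_additive : semi_sigma_additive mean_measure.
Proof.
move=> F mF tF mUF.
rewrite [X in X @ _ --> _](_ : _ =
    (fun n => (r%:R^-1)%:E * \sum_(i < r) \sum_(0 <= k < n) mu i (F k))).
  apply: cvgeZl => //; apply: cvg_nnesum => i _.
    by apply: nearW => n; exact: sume_ge0.
  exact: measure_semi_sigma_additive.
apply/funext => n; rewrite exchange_big/= ge0_sume_distrr// => k _.
exact: sume_ge0.
Qed.

HB.instance Definition _ := isMeasure.Build _ _ _ mean_measure
  mean_measure0 mean_measure_ge0 mean_measure_sigma_additive.

Lemma ex_mean_probability : (0 < r)%N ->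
  exists P : probability T R, forall A, P A = mean_measure A.
Proof.
move=> r0; have mT : mean_measure setT = 1.
  rewrite /mean_measure (eq_bigr (fun=> 1%:E))//; last first.
    by move=> i _; rewrite probability_setT.
  by rewrite sumEFin -EFinM sumr_const card_ord mulVf// pnatr_eq0 -lt0n.
(* The total mass is 1 only for positive [r], so the probability structure is packed locally, under
   [r0], rather than declared as an instance. *)
pose hP := Measure_isProbability.Build _ _ _ mean_measure mT.
pose P : probability T R := HB.pack mean_measure hP.
by exists P.
Qed.

Lemma mean_dominates (P : {measure set T -> \bar R}) :
  (forall i, mu i `<< P) -> mean_measure `<< P.
Proof.
move=> muP N PN A mA AN; rewrite /mean_measure big1 ?mule0// => i _.
exact: (muP i N).
Qed.

(** The weight [r%:R^-1] is nonzero, and a vanishing sum of nonnegative terms has only zero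
    terms. *)
Lemma dominates_mean i : (0 < r)%N -> mu i `<< mean_measure.
Proof.
move=> r0 N PN A mA AN; have /eqP := PN A mA AN.
rewrite /mean_measure mule_eq0 eqe invr_eq0 pnatr_eq0 -leqn0 leqNgt r0/=.
by rewrite seq_psume_eq0// => /allP/(_ i); rewrite mem_index_enum => /(_ isT)/eqP.
Qed.

End mean_measure.

(** * Densities with respect to an arbitrary measure [la] *)

Section density_lemmas.
Context d (T : measurableType d) (R : realType).
Variable la : {measure set T -> \bar R}.
Implicit Types P Q : probability T R.

Lemma is_density_eq P Q f : (forall A, measurable A -> P A = Q A) ->
  is_density la P f -> is_density la Q f.
Proof. by move=> PQ [fi Pf]; split => // A mA; rewrite -PQ// Pf. Qed.

Lemma is_density_measurable P f : is_density la P f -> measurable_fun setT f.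
Proof. by move=> [fi _]; apply/measurable_EFinP; exact: measurable_int fi. Qed.

(** Integrable functions with equal integrals over every measurable set agree almost everywhere. *)
Lemma is_density_unique P f g : is_density la P f -> is_density la P g ->
  \forall x \ae la, f x = g x.
Proof.
move=> [fi Pf] [gi Pg].
have : ae_eq la setT (EFin \o f) (EFin \o g).
  apply: integral_ae_eq => //; first exact: measurable_int gi.
  by move=> A _ mA; rewrite -[LHS]Pf// -[RHS]Pg.
by apply: filterS => x /= /(_ I) [].
Qed.

Lemma is_density_ae P Q f g : is_density la P f -> is_density la Q g ->
  (\forall x \ae la, f x = g x) -> forall A, measurable A -> P A = Q A.
Proof.
move=> [fi Pf] [gi Qg] fg A mA; rewrite Pf// Qg//.
apply: ae_eq_integral => //.
- by apply: measurable_funS (measurable_int _ fi).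
- by apply: measurable_funS (measurable_int _ gi).
- by apply: filterS fg => x -> _.
Qed.

Lemma is_density_mean (r : nat) (mu : 'I_r -> probability T R) f P :
  (forall i, is_density la (mu i) (f i)) ->
  (forall A, measurable A -> P A = mean_measure mu A) ->
  is_density la P (fun x => r%:R^-1 * \sum_(i < r) f i x)%R.
Proof.
move=> muf PE.
have E : EFin \o (fun x => r%:R^-1 * \sum_(i < r) f i x)%R =
    (fun x => (r%:R^-1)%:E * \sum_(i < r) (f i x)%:E).
  by apply/funext => x /=; rewrite EFinM sumEFin.
have fi i A : measurable A -> la.-integrable A (EFin \o f i).
  by move=> mA; apply: (integrableS measurableT) => //; case: (muf i).
have sfi A : measurable A ->
    la.-integrable A (fun x => \sum_(i < r) (f i x)%:E).
  by move=> mA; apply: integrable_sum => // i _; exact: fi.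
split; first by rewrite E; apply: integrableZl => //; exact: sfi.
move=> A mA; rewrite [RHS](_ : _ =
    \int[la]_(x in A) ((r%:R^-1)%:E * \sum_(i < r) (f i x)%:E)); last first.
  by apply: eq_integral => x _; rewrite EFinM sumEFin.
rewrite integralZl//; last exact: sfi.
rewrite integral_sum//; last by move=> i; exact: fi.
by rewrite PE//; congr (_ * _); apply: eq_bigr => i _; case: (muf i) => _ ->.
Qed.

End density_lemmas.

(** * Compromises, Gibbs compromises and the energy *)

Section compromises.
Context (R : realType) (r : nat) (r_gt0 : (0 < r)%N).
Context (d : 'I_r -> measure_display) (T : forall i, measurableType (d i)).
Variable pi : forall i, R.-pker (others T i) ~> T i.
Implicit Types P Q : probability (mprod T) R.

(** The measure nu_i of the overview. The Gibbs equation says that [P] agrees with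
    [mean_measure (component P)] on measurable sets. *)
Definition component P (i : 'I_r) : probability (mprod T) R :=
  ker_measure (pi i) (marginal i P).

Lemma marginal_eq P Q i : (forall A, measurable A -> P A = Q A) ->
  forall A, measurable A -> marginal i P A = marginal i Q A.
Proof.
move=> PQ A mA; apply: PQ; rewrite -[X in measurable X]setTI.
exact: measurable_drop_coord.
Qed.

(** The marginal enters a component only as the measure of an integral, which depends on its values
    on measurable sets alone. *)
Lemma component_eq P Q i :
  (forall A, measurable A -> marginal i P A = marginal i Q A) ->
  forall A, component P i A = component Q i A.
Proof.
by move=> PQ A; apply: eq_measure_integral => B mB _; exact: PQ.
Qed.

(** Each component is dominated by the mean of all of them, which is [P]; compatibility is the Gibbs
    equation on preimages under [drop_coord i]. *)
Lemma Gibbs_compromise_compromise P : Gibbs_compromise pi P -> compromise pi P.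
Proof.
move=> GP; split=> [i|i A mA].
  move=> N PN; apply: (@dominates_mean _ _ _ _ (component P) i r_gt0 N).
  by move=> A mA AN; rewrite -(PN A mA AN); exact/esym/GP.
apply: GP; rewrite -[X in measurable X]setTI; exact: measurable_drop_coord.
Qed.

Lemma compromise_Gibbs P : compromise pi P ->
  exists2 Q, Gibbs_compromise pi Q &
  [/\ forall A, Q A = mean_measure (component P) A &
      forall i A, component Q i A = component P i A].
Proof.
move=> [_ compP]; have [Q QE] := ex_mean_probability (component P) r_gt0.
have QP i A : component Q i A = component P i A.
  (* Compatibility turns [marginal i P B] into the mean of the components of [P] on the preimage of
     [B], which is the value of [Q] there. *)
  by apply: component_eq => B mB; rewrite [RHS]compP//; exact: QE.
exists Q => // A mA; rewrite QE /mean_measure; congr (_ * _).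
by apply: eq_bigr => i _; rewrite -QP.
Qed.

(** The densities that [energy] selects by [xget] agree almost everywhere with any given ones, so
    the integrals can be computed with the latter. *)
Lemma energyE (la : {measure set (mprod T) -> \bar R}) P f q :
  (forall i, is_density la (component P i) (f i)) -> is_density la P q ->
  energy pi la P = \int[la]_w (\sum_(i < r) (f i w - q w) ^+ 2)%:E.
Proof.
move=> Pf Pq; rewrite /energy; case: asboolP => [_|]; last first.
  by case; split=> [|i]; [exists q|exists (f i); exact: Pf].
have mf i := is_density_measurable (Pf i).
have mq := is_density_measurable Pq.
have dP : is_density la P (density la P) by apply: densityP; exists q.
have dPi i : is_density la (component P i) (density la (component P i)).
  by apply: densityP; exists (f i); exact: Pf.
have msq (g h : mprod T -> R) : measurable_fun setT g ->
    measurable_fun setT h ->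
    measurable_fun setT (fun w => ((g w - h w) ^+ 2)%:E).
  by move=> mg mh; apply/measurable_EFinP; apply: measurable_funX;
    exact: measurable_funB.
under [RHS]eq_integral do rewrite -sumEFin.
rewrite ge0_integral_sum//; last 2 first.
  by move=> i; exact: msq.
  by move=> i w _; rewrite lee_fin sqr_ge0.
apply: eq_bigr => i _; apply: ge0_ae_eq_integral => //.
- by apply: msq; [exact: is_density_measurable (dPi i)|
                  exact: is_density_measurable dP].
- exact: msq.
- by move=> w _; rewrite lee_fin sqr_ge0.
- by move=> w _; rewrite lee_fin sqr_ge0.
have H1 := is_density_unique (dPi i) (Pf i).
have H2 := is_density_unique dP Pq.
by apply: filterS2 H1 H2 => w /= -> -> _.
Qed.

End compromises.

(** Variance decomposition: the cross term vanishes because the deviations [f i - p] sum to zero. *)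
Lemma sum_sqr_sub_mean (R : numFieldType) (r : nat) (f : 'I_r -> R) (q : R) :
  (0 < r)%N -> let p := (r%:R^-1 * \sum_(i < r) f i)%R in
  (\sum_(i < r) (f i - q) ^+ 2 =
   \sum_(i < r) (f i - p) ^+ 2 + r%:R * (p - q) ^+ 2)%R.
Proof.
move=> r0 p.
have sf : (\sum_(i < r) f i = r%:R * p)%R.
  by rewrite mulrA mulfV ?mul1r// pnatr_eq0 -lt0n.
(* Expanding around a generic centre [c] serves both [c = q] and [c = p]. *)
have sqE c : (\sum_(i < r) (f i - c) ^+ 2 =
    \sum_(i < r) f i ^+ 2 - 2 * c * (r%:R * p) + r%:R * c ^+ 2)%R.
  rewrite -sf mulr_sumr -sumrB.
  rewrite [X in (_ + X)%R](_ : _ = \sum_(i < r) c ^+ 2)%R.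
    by rewrite -big_split/=; apply: eq_bigr => i _; ring.
  by rewrite sumr_const card_ord mulr_natl.
by rewrite !sqE; ring.
Qed.

(** * Comparison of a unique Gibbs compromise with all compromises *)

Section optimality.
Context (R : realType) (r : nat) (r_gt0 : (0 < r)%N).
Context (d : 'I_r -> measure_display) (T : forall i, measurableType (d i)).
Variable pi : forall i, R.-pker (others T i) ~> T i.
Variable PG : probability (mprod T) R.
Hypothesis PG_unique : forall P : probability (mprod T) R,
  Gibbs_compromise pi P -> forall A, measurable A -> P A = PG A.

Lemma compromise_component P i A : compromise pi P ->
  component pi PG i A = component pi P i A.
Proof.
move=> /(compromise_Gibbs r_gt0)[Q GQ [_ <-]].
apply: component_eq => B mB; apply: marginal_eq => // C mC.
by rewrite (PG_unique GQ).
Qed.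

Lemma compromise_mean P A : compromise pi P -> measurable A ->
  PG A = mean_measure (component pi P) A.
Proof.
by move=> /(compromise_Gibbs r_gt0)[Q GQ [<- _]] mA; rewrite (PG_unique GQ).
Qed.

Lemma compromise_dominates P : compromise pi P -> PG `<< P.
Proof.
move=> cP N PN A mA AN; rewrite (compromise_mean cP)//.
by apply: (@mean_dominates _ _ _ _ (component pi P) P cP.1 N).
Qed.

(** Densities pass from [P] to [PG]: the same [f i] are densities of the components of [PG], and
    their mean is a density of [PG]. *)
Lemma compromise_energy (la : {measure set (mprod T) -> \bar R}) P f q :
  compromise pi P ->
  (forall i, is_density la (component pi P i) (f i)) -> is_density la P q ->
  let p w := (r%:R^-1 * \sum_(i < r) f i w)%R in
  is_density la PG p /\
  energy pi la P =
    energy pi la PG + \int[la]_w (r%:R * (p w - q w) ^+ 2)%:E.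
Proof.
move=> cP Pf Pq p.
have PGp : is_density la PG p.
  by apply: is_density_mean Pf _ => A; exact: compromise_mean.
have PGf i : is_density la (component pi PG i) (f i).
  by apply: is_density_eq (Pf i) => A mA; exact/esym/compromise_component.
split=> //; rewrite (energyE Pf Pq) (energyE PGf PGp).
have mf i := is_density_measurable (Pf i).
have mq := is_density_measurable Pq.
have mp := is_density_measurable PGp.
rewrite -ge0_integralD//.
- by apply: eq_integral => w _; rewrite -EFinD -sum_sqr_sub_mean.
- by move=> w _; rewrite lee_fin; apply: sumr_ge0 => i _; exact: sqr_ge0.
- apply/measurable_EFinP; apply: measurable_sum => i.
  by apply: measurable_funX; exact: measurable_funB.
- by move=> w _; rewrite lee_fin mulr_ge0 ?sqr_ge0.
- apply/measurable_EFinP; apply: measurable_funM => //.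
  by apply: measurable_funX; exact: measurable_funB.
Qed.

Lemma le_energy_compromise (la : {measure set (mprod T) -> \bar R}) P :
  compromise pi P -> energy pi la PG <= energy pi la P.
Proof.
(* If some density is missing, the energy of [P] is [+oo] by convention. *)
move=> cP; have [[[q Pq] Pf]|nd] := pselect (has_densities pi la P); last first.
  by rewrite [X in _ <= X]/energy asboolF// leey.
have [f {}Pf] := choice Pf.
have [_ ->] := compromise_energy cP Pf Pq.
by rewrite leeDl// integral_ge0// => w _; rewrite lee_fin mulr_ge0 ?sqr_ge0.
Qed.

(** Finiteness allows [energy pi la PG] to be cancelled. Were it [+oo], every compromise would have
    infinite energy by [le_energy_compromise], and minimality would select nothing. *)
Lemma compromise_energy_eq (la : {measure set (mprod T) -> \bar R}) P :
  compromise pi P -> energy pi la P <= energy pi la PG ->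
  energy pi la PG < +oo -> forall A, measurable A -> P A = PG A.
Proof.
move=> cP PPG PGoo.
have [[[q Pq] Pf]|nd] := pselect (has_densities pi la P); last first.
  by move: (le_lt_trans PPG PGoo); rewrite /energy asboolF// ltxx.
have [f {}Pf] := choice Pf.
have [PGp E] := compromise_energy cP Pf Pq.
set p := (fun w => r%:R^-1 * _)%R in PGp E.
have I0 : 0 <= \int[la]_w (r%:R * (p w - q w) ^+ 2)%:E.
  by apply: integral_ge0 => w _; rewrite lee_fin mulr_ge0 ?sqr_ge0.
have PG0 : 0 <= energy pi la PG.
  rewrite /energy; case: asboolP => // _; apply: sume_ge0 => i _.
  by apply: integral_ge0 => w _; rewrite lee_fin sqr_ge0.
have PGfin : energy pi la PG \is a fin_num by rewrite ge0_fin_numE.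
(* By [E] this integral is the excess of the energy of [P] over that of [PG], at most 0 by [PPG]. *)
have /eqP I00 : \int[la]_w (r%:R * (p w - q w) ^+ 2)%:E == 0.
  by rewrite eq_le I0 andbT -(leeD2lE _ _ PGfin) -E adde0.
have mg : measurable_fun setT (fun w => (r%:R * (p w - q w) ^+ 2)%:E).
  apply/measurable_EFinP; apply: measurable_funM => //.
  apply: measurable_funX; apply: measurable_funB.
    exact: is_density_measurable PGp.
  exact: is_density_measurable Pq.
have /(ae_eq_integral_abs la measurableT mg) ae0 :
    \int[la]_w `|(r%:R * (p w - q w) ^+ 2)%:E| = 0.
  rewrite -[RHS]I00; apply: eq_integral => w _.
  by rewrite gee0_abs// lee_fin mulr_ge0 ?sqr_ge0.
apply: (is_density_ae Pq PGp).
apply: filterS ae0 => w /= /(_ I) [] /eqP.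
by rewrite mulf_eq0 pnatr_eq0 -leqn0 leqNgt r_gt0/= sqrf_eq0 subr_eq0 => /eqP.
Qed.

End optimality.

Theorem theorem2p10 (R : realType) (r : nat) (r_gt0 : (0 < r)%N)
    (d : 'I_r -> measure_display) (T : forall i : 'I_r, measurableType (d i))
    (pi : forall i : 'I_r, R.-pker (others T i) ~> T i)
    (PG : probability (mprod T) R)
    (PG_Gibbs : Gibbs_compromise pi PG)
    (PG_unique : forall P : probability (mprod T) R, Gibbs_compromise pi P ->
       forall A : set (mprod T), measurable A -> P A = PG A) :
  (forall P : probability (mprod T) R, compromise pi P -> PG `<< P) /\
  (forall la : {measure set (mprod T) -> \bar R}, PG `<< la ->
     optimal_compromise pi la PG /\
     (energy pi la PG < +oo ->
      forall P : probability (mprod T) R, optimal_compromise pi la P ->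
        forall A : set (mprod T), measurable A -> P A = PG A)).
Proof.
have cPG := Gibbs_compromise_compromise r_gt0 PG_Gibbs.
split=> [P|la PGla]; first exact: compromise_dominates.
split=> [|PGoo P [cP _ minP]].
  by split=> // Q cQ _; exact: le_energy_compromise.
(* [PG] is itself an admissible competitor, so minimality of [P] bounds its energy by that of
   [PG]. *)
exact: compromise_energy_eq (minP _ cPG PGla) PGoo.
Qed.
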